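(* Let $G$ be a connected graph with a perfect matching. Then $Af(G)\leq r(G)$. Further, if $G$ is nonbipartite, then $Af(G)<r(G)$.
   Context: All graphs are finite and simple. For a perfect matching $M$ of $G$, a set $S\subseteq E(G)\setminus M$ is an anti-forcing set of $M$ if $M$ is the unique perfect matching of $G-S$; $af(G,M)$ is the minimum cardinality of an anti-forcing set of $M$. $Af(G)$ is the maximum of $af(G,M)$ over all perfect matchings $M$ of $G$. For a connected graph $G$, $r(G)=|E(G)|-|V(G)|+1$ is its cyclomatic number. *)

(* Defs.v *)
(* A finite simple graph on the vertex set T is a
   symmetric and irreflexive relation e : rel T. *)
From mathcomp Require Import all_boot all_order ssralg ssrnum ssrint.

Set Implicit Arguments.
Unset Strict Implicit.
Unset Printing Implicit Defensive.

Section Graphs.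
Variable T : finType.
Implicit Types (e : rel T) (M N S : {set {set T}}).

Definition edges e : {set {set T}} :=
  [set [set p.1; p.2] | p in [pred p : T * T | e p.1 p.2]].

Definition del_edges e S : rel T :=
  [rel x y | e x y && ([set x; y] \notin S)].

(* Null graphs are not considered connected. *)
Definition connected_graph e : Prop :=
  0 < #|T| /\ forall x y : T, connect e x y.

Definition bipartite e : Prop :=
  exists A : {set T}, forall x y : T, e x y -> (x \in A) != (y \in A).

Definition perfect_matching e M : bool :=
  (M \subset edges e) && [forall v : T, #|[set a in M | v \in a]| == 1].

Definition anti_forcing_set e M S : bool :=
  (S \subset edges e :\: M) &&
  [forall N, perfect_matching (del_edges e S) N == (N == M)].

(* The default value edges e :\: M is itself an anti-forcing set of a perfect
   matching M, see anti_forcing_setD below, so this is a genuine minimum. *)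
Definition af e M : nat :=
  #|[arg min_(S < edges e :\: M | anti_forcing_set e M S) #|S|]|.

Definition Af e : nat := \max_(M | perfect_matching e M) af e M.

Definition cyclomatic e : int := (#|edges e|%:Z - #|T|%:Z + 1)%R.

Lemma edges_del e S : edges (del_edges e S) = edges e :\: S.
Proof.
apply/setP=> a; rewrite in_setD; apply/imsetP/andP.
  case=> -[x y]; rewrite inE /= => /andP[exy xyS] ->; split=> //.
  by apply/imsetP; exists (x, y).
case=> aS /imsetP[[x y]]; rewrite inE /= => exy def_a.
by exists (x, y) => //; rewrite inE /del_edges /= exy -def_a.
Qed.

Lemma anti_forcing_setD e M :
  perfect_matching e M -> anti_forcing_set e M (edges e :\: M).
Proof.
case/andP=> sME /forallP M1; rewrite /anti_forcing_set subxx /=.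
apply/forallP=> N; rewrite /perfect_matching edges_del setDDr setDv set0U.
rewrite (setIidPr sME); apply/eqP; apply/idP/eqP; last first.
  by move=> ->; rewrite subxx; apply/forallP.
case/andP=> sNM /forallP N1; apply/eqP; rewrite eqEsubset sNM /=.
apply/subsetP=> a aM.
have /imsetP[[x y] _ /= def_a] := subsetP sME a aM.
have xa : x \in a by rewrite def_a !inE eqxx.
have /cards1P[b Nb] := N1 x; have /cards1P[c Mc] := M1 x.
have : b \in [set a in N | x \in a] by rewrite Nb set11.
rewrite inE => /andP[bN xb].
have : b \in [set a in M | x \in a] by rewrite inE (subsetP sNM) ?xb.
have : a \in [set a in M | x \in a] by rewrite inE aM.
by rewrite Mc !inE => /eqP-> /eqP<-.
Qed.

End Graphs.

(* Main.v *)
Require Import Defs.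
From mathcomp Require Import all_boot all_order ssralg ssrnum ssrint.
From mathcomp Require Import zify.

(** Fix a perfect matching M and let F be the edge set of a spanning tree
    containing M.  A forest has at most one perfect matching, so deleting the
    edges outside F leaves M as the only perfect matching; the number of deleted
    edges is |E| - (|V| - 1) = r.

    If the graph is not bipartite, let A be one colour class of the proper
    2-colouring of the tree F.  Some edge uv of the graph has both ends in A or
    both outside A, so it is not in F, and it may be kept too.  Indeed M has
    |V| / 2 edges, each of them meeting A once, so |A| = |V| / 2.  A perfect
    matching N of F + uv also has |V| / 2 edges; if it used uv, all its other
    edges would meet A exactly once while uv meets A zero or two times, giving
    |A| = |V| / 2 - 1 or |V| / 2 + 1.  Hence N avoids uv, lies in F and equals M.
    This saves one deleted edge.

    Trees are not treated through cycles.  The tree is grown from one edge of M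
    by adding, at each step, an edge xy leaving the current vertex set together
    with the matching edge b at y (predicate [grown]).  The end of b other than y
    is then a leaf, so b belongs to every perfect matching and xy to none: this
    gives uniqueness by induction ([grown_unique]).  Connectedness ensures that
    the growth reaches all vertices ([grown_spanning]). *)

Set Implicit Arguments.
Unset Strict Implicit.
Unset Printing Implicit Defensive.

(** * Perfect matchings as exact covers *)

Section MatchingTrees.
Variables (T : finType) (e : rel T).
Implicit Types (x y u v : T) (a b X A : {set T}) (M N F : {set {set T}}).

Definition covers_once N X : Prop :=
  {in X, forall v, #|[set a in N | v \in a]| = 1}.

Lemma perfect_matchingP M :
  reflect (M \subset edges e /\ covers_once M setT) (perfect_matching e M).
Proof.
apply: (iffP andP) => -[sME M1]; split=> //.
  by move=> v _; apply/eqP/(forallP M1).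
by apply/forallP=> v; apply/eqP/M1; rewrite inE.
Qed.

Lemma covers_once_ex N X v : covers_once N X -> v \in X ->
  exists2 a, a \in N & v \in a.
Proof.
move=> N1 /N1/eqP/cards1P[a Na]; have := set11 a.
by rewrite -Na inE => /andP[]; exists a.
Qed.

Lemma covers_once_inj N X v a b : covers_once N X -> v \in X ->
  a \in N -> b \in N -> v \in a -> v \in b -> a = b.
Proof.
move=> N1 /N1/eqP/cards1P[c Nc] aN bN va vb.
have : a \in [set a in N | v \in a] by rewrite inE aN.
have : b \in [set a in N | v \in a] by rewrite inE bN.
by rewrite Nc !inE => /eqP-> /eqP->.
Qed.

(** Double counting of the pairs (v, a) with v in A covered by a in N. *)
Lemma card_covers_once N A : covers_once N setT ->
  #|A| = \sum_(a in N) #|a :&: A|.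
Proof.
move=> N1; rewrite -sum1_card.
under [RHS]eq_bigr do rewrite -sum1_card.
rewrite (exchange_big_dep (mem A)) /=; last by move=> a v _ /setIP[].
apply: eq_bigr => v vA; rewrite -[LHS](N1 v (in_setT v)) -sum1_card.
by apply: eq_bigl => a; rewrite !inE vA andbT.
Qed.

Lemma mem_edges x y : e x y -> [set x; y] \in edges e.
Proof. by move=> exy; apply/imsetP; exists (x, y). Qed.

Hypothesis e_irr : irreflexive e.

Lemma card_edge a : a \in edges e -> #|a| = 2.
Proof.
case/imsetP=> -[x y]; rewrite inE /= => exy ->; rewrite cards2.
by have [xy|//] := eqVneq x y; rewrite xy e_irr in exy.
Qed.

Lemma card_monochromatic u v A : e u v -> (u \in A) = (v \in A) ->
  #|[set u; v] :&: A| != 1.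
Proof.
move=> euv uvA; case uA: (u \in A).
  rewrite (setIidPl _) ?card_edge ?mem_edges //.
  by rewrite subUset !sub1set -uvA uA.
rewrite disjoint_setI0 ?cards0 // disjoints_subset subUset !sub1set.
by rewrite !inE -uvA uA.
Qed.

Lemma double_card_matching N : N \subset edges e -> covers_once N setT ->
  #|T| = 2 * #|N|.
Proof.
move=> /subsetP sNE N1; rewrite -cardsT (card_covers_once _ N1) mulnC.
rewrite -sum_nat_const; apply: eq_bigr => a aN.
by rewrite setIT card_edge ?sNE.
Qed.

(** * Growing a spanning tree around a perfect matching *)

(** The vertex set X carries a tree F, which contains every edge of M that
    meets X, and A is a colour class of this tree.  The colour class is extended
    so that exactly one of x, y and exactly one end of b belong to it. *)
Inductive grown M : {set T} -> {set {set T}} -> {set T} -> Prop :=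
| GrownEdge a x : a \in M -> x \in a -> grown M a [set a] [set x]
| GrownStep X F A x y b : grown M X F A -> x \in X -> y \notin X -> e x y ->
    b \in M -> y \in b ->
    grown M (X :|: b) ([set x; y] |: (b |: F))
          (A :|: (if x \in A then b :\ y else [set y])).

Section Grown.
Variable M : {set {set T}}.
Hypotheses (sME : M \subset edges e) (M1 : covers_once M setT).

(** Each step adds a whole edge of M, so an edge of M that meets X lies in X; this
    is what makes the next matching edge b disjoint from X. *)
Lemma grown_closed X F A a v : grown M X F A ->
  a \in M -> v \in a -> v \in X -> (a \subset X) && (a \in F).
Proof.
move=> gr aM va.
elim: gr => {X F A} [b x bM xb|X F A x y b _ IH xX yX exy bM yb].
  by move=> vb; rewrite (covers_once_inj M1 (in_setT v) aM bM va vb) subxx set11.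
case/setUP=> [/IH/andP[aX aF]|vb].
  by rewrite subsetU ?aX // !inE aF !orbT.
rewrite (covers_once_inj M1 (in_setT v) aM bM va vb) subsetUr !inE eqxx.
by rewrite orbT.
Qed.

Lemma grown_spanning_sub F A : grown M setT F A -> M \subset F.
Proof.
move=> gr; apply/subsetP=> a aM.
have /card_gt0P[v va] : 0 < #|a| by rewrite card_edge ?(subsetP sME).
by have /andP[] := grown_closed gr aM va (in_setT v).
Qed.

Lemma grown_disjoint X F A b y : grown M X F A -> y \notin X ->
  b \in M -> y \in b -> [disjoint b & X].
Proof.
move=> gr yX bM yb; apply/pred0P=> v /=; apply/negP=> /andP[vb vX].
have /andP[/subsetP/(_ y yb) yX' _] := grown_closed gr bM vb vX.
by rewrite yX' in yX.
Qed.

Lemma grown_sub X F A : grown M X F A ->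
  [/\ A \subset X, F \subset edges e & {in F, forall a, a \subset X}].
Proof.
elim=> {X F A} [b x bM xb|X F A x y b _ [AX FE FX] xX yX exy bM yb].
  by rewrite !sub1set xb (subsetP sME) //; split=> // a /set1P->.
split.
- apply: setUSS => //; case: ifP => _; first exact: subD1set.
  by rewrite sub1set.
- by rewrite !subUset FE !sub1set mem_edges //= (subsetP sME).
- move=> a; rewrite !inE => /or3P[/eqP->|/eqP->|/FX aX].
  + by rewrite subUset !sub1set !inE xX yb orbT.
  + exact: subsetUr.
  + exact: subset_trans aX (subsetUl _ _).
Qed.

Lemma grown_card X F A : grown M X F A -> #|F|.+1 = #|X|.
Proof.
elim=> {X F A} [b x bM xb|X F A x y b gr IH xX yX exy bM yb].
  by rewrite cards1 card_edge ?(subsetP sME).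
have [_ _ FX] := grown_sub gr; have dbX := grown_disjoint gr yX bM yb.
have outF a : y \in a -> a \notin F.
  by move=> ya; apply/negP=> /FX/subsetP/(_ y ya); apply/negP.
have nxb : x \notin b by apply/negP => /(disjointFr dbX); rewrite xX.
rewrite cardsU (setIC X) (disjoint_setI0 dbX) cards0 subn0 -IH.
rewrite (card_edge (subsetP sME _ bM)) !cardsU1 (outF _ yb).
have -> : [set x; y] \notin b |: F.
  rewrite in_setU1 negb_or outF ?set22 // andbT.
  by apply/eqP=> xyb; rewrite -xyb set21 in nxb.
lia.
Qed.

Lemma grown_colouring X F A : grown M X F A ->
  {in F, forall a, #|a :&: A| = 1}.
Proof.
elim=> {X F A} [b x bM xb|X F A x y b gr IH xX yX exy bM yb].
  by move=> a /set1P->; rewrite (setIidPr _) ?sub1set // cards1.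
have [AX _ FX] := grown_sub gr; have dbX := grown_disjoint gr yX bM yb.
have xb : x \in b = false.
  by apply/negbTE/negP=> /(disjointFr dbX); rewrite xX.
have yx : y == x = false by apply/negbTE/eqP=> yx; rewrite yx xX in yX.
have yA : y \in A = false by apply/negbTE/negP=> /(subsetP AX); apply/negP.
have bA : b :&: A = set0.
  by apply: disjoint_setI0; apply: disjointWr dbX.
set B := if _ then _ else _.
have sBb : B \subset b.
  by rewrite /B; case: ifP => _; [apply: subD1set | rewrite sub1set].
have bB : #|B| = 1.
  rewrite /B; case: ifP => _; last exact: cards1.
  by have := cardsD1 y b; rewrite yb card_edge ?(subsetP sME) // => -[].
move=> a; rewrite !inE => /or3P[/eqP->|/eqP->|aF].
- have -> : [set x; y] :&: (A :|: B) = [set if x \in A then x else y].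
    apply/setP=> v; rewrite /B !inE.
    have [->|vx] := eqVneq v x; last have [->|vy] := eqVneq v y.
    + by rewrite eq_sym in yx; case: ifP => xA; rewrite !inE ?eqxx ?xA //= yx.
    + by case: ifP => xA; rewrite !inE yA eqxx ?yx.
    + by case: ifP => _; rewrite ?(negbTE vx) ?(negbTE vy).
  by rewrite cards1.
- by rewrite setIUr bA set0U (setIidPr sBb).
- have aB : a :&: B = set0.
    apply: disjoint_setI0; rewrite disjoint_sym.
    by apply: disjointWl sBb _; apply: disjointWr (FX a aF) dbX.
  by rewrite setIUr aB setU0 IH.
Qed.

(** Let z be the end of b other than y.  The only edge at z is b, so b lies in
    N; then y is covered by b, so xy is not in N, and N minus b lies in the
    smaller tree and still covers each vertex of X once. *)
Lemma grown_unique X F A N : grown M X F A ->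
  N \subset F -> covers_once N X -> N \subset M.
Proof.
move=> gr.
elim: gr N => {X F A} [b x bM xb|X F A x y b gr IH xX yX exy bM yb]
  N sNF N1.
  by apply: subset_trans sNF _; rewrite sub1set.
have [_ _ FX] := grown_sub gr; have dbX := grown_disjoint gr yX bM yb.
have xb : x \notin b by apply/negP => /(disjointFr dbX); rewrite xX.
have [z zb zy] : exists2 z, z \in b & z != y.
  have /set0Pn[z] : b :\ y != set0.
    rewrite -card_gt0; have := cardsD1 y b.
    by rewrite yb card_edge ?(subsetP sME) //; lia.
  by case/setD1P; exists z.
have bN : b \in N.
  have [|a aN za] := covers_once_ex (v := z) N1; first by rewrite inE zb orbT.
  have := subsetP sNF a aN; rewrite !inE.
  case/or3P=> [/eqP xya|/eqP<-//|/FX/subsetP/(_ z za)].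
    move: za; rewrite xya !inE (negbTE zy) orbF => /eqP zx.
    by rewrite -zx zb in xb.
  by rewrite (disjointFr dbX zb).
have xyN : [set x; y] \notin N.
  apply/negP=> xyN.
  have yXb : y \in X :|: b by rewrite inE yb orbT.
  have xyb := covers_once_inj N1 yXb xyN bN (set22 x y) yb.
  by rewrite -xyb set21 in xb.
have sub : N :\ b \subset M.
  apply: IH.
    apply/subsetP=> a /setD1P[ab aN]; have := subsetP sNF a aN.
    rewrite !inE (negbTE ab) => /orP[/eqP xya|//].
    by rewrite -xya aN in xyN.
  move=> v vX; rewrite -[RHS](N1 v); last by rewrite inE vX.
  apply: eq_card => a; rewrite !inE.
  have [->|//] := eqVneq a b.
  by rewrite (disjointFl dbX vX) !andbF.
by rewrite -(setD1K bN) subUset sub1set bM.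
Qed.

Hypotheses (e_sym : symmetric e) (e_conn : connected_graph e).

Lemma edge_leaving X x : x \in X -> X != setT ->
  exists u v, [/\ u \in X, v \notin X & e u v].
Proof.
have [_ conn] := e_conn => xX.
have [/existsP[u /existsP[v /and3P[uX vX euv]]] _|noE] :=
  boolP [exists u, exists v, [&& u \in X, v \notin X & e u v]].
  by exists u, v.
case/eqP; apply/setP=> z; rewrite inE.
have clX : closed e X.
  apply: (intro_closed (sym_connect_sym e_sym)) => u v euv uX.
  apply: contraNT noE => vX; apply/existsP; exists u; apply/existsP; exists v.
  by rewrite uX vX.
by rewrite -(closed_connect clX (conn x z)).
Qed.

Lemma grown_spanning : exists F A, grown M setT F A.
Proof.
have [/card_gt0P[x0 _] _] := e_conn.
have [a aM xa] := covers_once_ex M1 (in_setT x0).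
have ext k X F A : #|~: X| < k -> x0 \in X -> grown M X F A ->
    exists F' A', grown M setT F' A'.
  elim: k X F A => // k IH X F A ltXk x0X gr.
  have [XT|XT] := eqVneq X setT; first by exists F, A; rewrite -XT.
  have [x [y [xX yX exy]]] := edge_leaving x0X XT.
  have [b bM yb] := covers_once_ex M1 (in_setT y).
  apply: IH (GrownStep gr xX yX exy bM yb); last by rewrite inE x0X.
  rewrite ltnS in ltXk; apply: leq_trans ltXk; apply: proper_card.
  rewrite properEneq setCS subsetUl andbT; apply/eqP=> /setP/(_ y).
  by rewrite !inE yb orbT yX.
exact: ext (ltnSn _) xa (GrownEdge aM xa).
Qed.

(** An end of an edge a of M is covered by an edge of N, which is also in M and
    hence is a.  This is why [grown_unique] may conclude with an inclusion. *)
Lemma matching_eq N : N \subset M -> covers_once N setT -> N = M.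
Proof.
move=> /subsetP sNM N1; apply/setP=> a; apply/idP/idP=> [/sNM //|aM].
have /card_gt0P[v va] : 0 < #|a| by rewrite card_edge ?(subsetP sME).
have [b bN vb] := covers_once_ex N1 (in_setT v).
by rewrite (covers_once_inj M1 (in_setT v) aM (sNM b bN) va vb).
Qed.

(** Why one more edge may be kept: an edge uv with both ends in the same colour
    class cannot belong to a perfect matching of the tree plus uv, since all
    perfect matchings have the same number of edges and the tree edges among
    them each meet A once. *)
Lemma grown_unique_add F A u v N : grown M setT F A ->
  e u v -> (u \in A) = (v \in A) ->
  N \subset [set u; v] |: F -> covers_once N setT -> N \subset M.
Proof.
move=> gr euv uvA sNF N1; apply: (grown_unique gr) (N1).
have [_ FE _] := grown_sub gr.
have F1 := grown_colouring gr.
have /subsetP MF := grown_spanning_sub gr.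
have NE : N \subset edges e.
  by apply: subset_trans sNF _; rewrite subUset sub1set mem_edges.
have cMN : #|M| = #|N|.
  have := double_card_matching sME M1; rewrite (double_card_matching NE N1); lia.
have cA : #|A| = #|M|.
  rewrite (card_covers_once A M1) -sum1_card.
  by apply: eq_bigr => a /MF/F1.
have uvN : [set u; v] \notin N.
  apply/negP=> uvN; have := card_covers_once A N1.
  rewrite (big_setD1 _ uvN) /= cA cMN (cardsD1 [set u; v] N) uvN.
  rewrite (eq_bigr (fun _ => 1)) ?sum1_card.
    by have := card_monochromatic euv uvA; lia.
  move=> a /setD1P[a_uv aN]; apply: F1.
  by have := subsetP sNF a aN; rewrite !inE (negbTE a_uv).
apply/subsetP=> a aN; have := subsetP sNF a aN.
by rewrite !inE => /orP[/eqP a_uv|//]; rewrite -a_uv aN in uvN.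
Qed.

End Grown.

(** * From kept edges to anti-forcing sets *)

(** The constructions above produce the set F of edges that are kept, so
    anti-forcing sets are handled through their complements. *)
Lemma anti_forcing_setC M F : perfect_matching e M ->
    F \subset edges e -> M \subset F ->
    (forall N, N \subset F -> covers_once N setT -> N \subset M) ->
  anti_forcing_set e M (edges e :\: F).
Proof.
case/perfect_matchingP=> sME M1 sFE sMF uniqM.
rewrite /anti_forcing_set setDS //=; apply/forallP=> N; apply/eqP.
have edgesF : edges (del_edges e (edges e :\: F)) = F.
  by rewrite edges_del setDDr setDv set0U (setIidPr sFE).
apply/idP/eqP=> [|->].
  rewrite /perfect_matching edgesF => /andP[sNF /forallP N1].
  have {}N1 : covers_once N setT by move=> v _; apply/eqP.
  exact: matching_eq sME M1 _ (uniqM N sNF N1) N1.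
rewrite /perfect_matching edgesF sMF /=.
by apply/forallP=> v; rewrite M1.
Qed.

(** A perfect matching must exist for this bound: otherwise [Af e] is an empty
    maximum, and nothing relates k to the number of edges. *)
Lemma leq_Af k : (exists M, perfect_matching e M) ->
    (forall M, perfect_matching e M -> exists F,
      [/\ F \subset edges e, M \subset F, k <= #|F| &
          forall N, N \subset F -> covers_once N setT -> N \subset M]) ->
  Af e + k <= #|edges e|.
Proof.
move=> [M0 pmM0] keep.
have leE M : perfect_matching e M -> af e M + k <= #|edges e|.
  move=> pmM; have [F [sFE sMF leF uniqM]] := keep M pmM.
  rewrite /af; case: arg_minnP => [|S _ minS]; first exact: anti_forcing_setD.
  have /minS := anti_forcing_setC pmM sFE sMF uniqM.
  have := subset_leq_card sFE; rewrite cardsD (setIidPr sFE); lia.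
have kE : k <= #|edges e| by have := leE M0 pmM0; lia.
suff : Af e <= #|edges e| - k by lia.
by apply/bigmax_leqP=> M /leE; lia.
Qed.

End MatchingTrees.

Theorem theorem3p1 (T : finType) (e : rel T)
  (e_sym : symmetric e) (e_irr : irreflexive e)
  (e_conn : connected_graph e)
  (e_pm : exists M : {set {set T}}, perfect_matching e M) :
  ((Af e)%:Z <= cyclomatic e)%R /\
  (~ bipartite e -> ((Af e)%:Z < cyclomatic e)%R).
Proof.
have T_gt0 := e_conn.1.
rewrite /cyclomatic; split=> [|nbip].
  suff : Af e + #|T|.-1 <= #|edges e| by lia.
  apply: leq_Af => // M /perfect_matchingP[sME M1].
  have [F [A gr]] := grown_spanning M1 e_sym e_conn.
  have [_ sFE _] := grown_sub sME gr; exists F; split=> //.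
  - exact: grown_spanning_sub gr.
  - by rewrite -cardsT -(grown_card e_irr sME M1 gr).
  - by move=> N; apply: grown_unique gr.
suff : Af e + #|T| <= #|edges e| by lia.
apply: leq_Af => // M /perfect_matchingP[sME M1].
have [F [A gr]] := grown_spanning M1 e_sym e_conn.
have [u [v [euv uvA]]] : exists u v, e u v /\ (u \in A) = (v \in A).
  have [/existsP[u /existsP[v /andP[euv /eqP uvA]]]|noE] :=
    boolP [exists u, exists v, e u v && ((u \in A) == (v \in A))].
    by exists u, v.
  case: nbip; exists A => u v euv; apply: contraNneq noE => uvA.
  by apply/existsP; exists u; apply/existsP; exists v; rewrite euv uvA eqxx.
have [_ sFE _] := grown_sub sME gr; exists ([set u; v] |: F); split.
- by rewrite subUset sub1set mem_edges.
- exact: subset_trans (grown_spanning_sub e_irr sME M1 gr) (subsetUr _ _).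
- have uvF : [set u; v] \notin F.
    apply/negP=> /(grown_colouring e_irr sME M1 gr)/eqP; apply/negP.
    exact: card_monochromatic.
  by rewrite cardsU1 uvF -cardsT -(grown_card e_irr sME M1 gr).
- by move=> N; apply: grown_unique_add gr euv uvA.
Qed.
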